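(* Let $n\ge 1$. The group $\mathrm{PL}(I^n,\mathcal{F})$ does not contain a free subgroup; that is, it contains no subgroup isomorphic to a free group of rank at least $2$.
   Context: Let $I=[0,1]$. $\mathrm{PL}(I^n)$ is the group of orientation-preserving homeomorphisms $f$ of the cube $I^n$ that are piecewise linear, i.e. such that there is a subdivision of $I^n$ into finitely many linear simplices with the restriction of $f$ to each simplex an affine linear homeomorphism onto its image. $\mathrm{PL}(I^n,\mathcal{F})$ is the subgroup of $\mathrm{PL}(I^n)$ consisting of those homeomorphisms that preserve each leaf of the foliation $\mathcal{F}$ of $I^n$ by vertical lines, i.e. $f(\{x\}\times I)=\{x\}\times I$ for every $x\in I^{n-1}$. *)

(* Defs.v *)
From HB Require Import structures.
From mathcomp Require Import all_boot all_order all_algebra.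
From mathcomp Require Import finmap.
From mathcomp Require Import all_classical all_reals topology.

Set Implicit Arguments.
Unset Strict Implicit.
Unset Printing Implicit Defensive.

Import Order.TTheory GRing.Theory Num.Theory.
Import numFieldTopology.Exports.

Local Open Scope classical_set_scope.
Local Open Scope ring_scope.

(* The free group on S, realised on reduced words: the letter (s, false)
   stands for the generator s and (s, true) for its inverse. *)
Section FreeGroup.
Variable S : choiceType.

Definition inv_letter (x : S * bool) : S * bool := (x.1, ~~ x.2).

Definition no_cancel : rel (S * bool) := fun x y => y != inv_letter x.

Definition reduced (w : seq (S * bool)) : bool := sorted no_cancel w.

(* Left multiplication of a reduced word by a letter. *)
Definition push (x : S * bool) (w : seq (S * bool)) : seq (S * bool) :=
  if w is y :: w' then (if y == inv_letter x then w' else x :: w) else [:: x].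

Record free_group : Type := FreeGroup {
  fg_word :> seq (S * bool);
  fg_reduced : reduced fg_word }.

HB.instance Definition _ := [isSub for fg_word].
HB.instance Definition _ := [Choice of free_group by <:].

Lemma inv_letterK : involutive inv_letter.
Proof. by case=> s b; rewrite /inv_letter /= negbK. Qed.

Lemma push_reduced x w : reduced w -> reduced (push x w).
Proof.
case: w => [//|y w] /= yw; case: ifP => [_|/negbT xy] /=.
  by move: yw; exact: path_sorted.
by rewrite /no_cancel xy.
Qed.

Lemma foldr_push_reduced u v : reduced v -> reduced (foldr push v u).
Proof. by move=> rv; elim: u => //= x u; exact: push_reduced. Qed.

Lemma pushK x w : reduced w -> push x (push (inv_letter x) w) = w.
Proof.
case: w => [|y w] /=; first by rewrite eqxx.
rewrite inv_letterK; case: eqVneq => [-> yw|_ _] /=; last by rewrite eqxx.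
case: w yw => [//|z w] /= /andP[].
by rewrite /no_cancel => /negbTE ->.
Qed.

Lemma foldr_push_push x v w : reduced w ->
  foldr push w (push x v) = push x (foldr push w v).
Proof.
move=> rw; case: v => [//|y v] /=; case: eqVneq => [->|_] //=.
by rewrite pushK // foldr_push_reduced.
Qed.

Lemma foldr_push_nil u : reduced u -> foldr push [::] u = u.
Proof.
elim: u => //= x u IH ru; rewrite IH; last exact: path_sorted ru.
case: u ru {IH} => [//|y u] /= /andP[xy _].
by rewrite (negbTE xy).
Qed.

Definition inv_word (w : seq (S * bool)) := rev (map inv_letter w).

Lemma inv_wordK : involutive inv_word.
Proof.
move=> w; rewrite /inv_word map_rev revK -map_comp -[RHS]map_id.
by apply: eq_map => x /=; rewrite inv_letterK.
Qed.

Lemma inv_word_reduced w : reduced w -> reduced (inv_word w).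
Proof.
rewrite /reduced /inv_word rev_sorted sorted_map.
apply: sub_sorted => x y /=; rewrite /no_cancel /= inv_letterK.
by apply: contraNN => /eqP ->.
Qed.

Lemma foldr_push_inv w : foldr push w (inv_word w) = [::].
Proof.
elim: w => //= x w IH; rewrite /inv_word /= rev_cons foldr_rcons /=.
by rewrite inv_letterK eqxx.
Qed.

Definition fg_one : free_group := @FreeGroup [::] isT.

Definition fg_mul (u v : free_group) : free_group :=
  FreeGroup (foldr_push_reduced u (fg_reduced v)).

Definition fg_inv (u : free_group) : free_group :=
  FreeGroup (inv_word_reduced (fg_reduced u)).

Lemma fg_mulA : associative fg_mul.
Proof.
move=> u v w; apply: val_inj => /=; elim: (fg_word u) => //= x s ->.
by rewrite foldr_push_push // fg_reduced.
Qed.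

Lemma fg_mul1 : left_id fg_one fg_mul.
Proof. by move=> u; apply: val_inj. Qed.

Lemma fg_mulr1 : right_id fg_one fg_mul.
Proof. by move=> u; apply: val_inj; rewrite /= foldr_push_nil ?fg_reduced. Qed.

Lemma fg_mulV : left_inverse fg_one fg_inv fg_mul.
Proof. by move=> u; apply: val_inj; rewrite /= foldr_push_inv. Qed.

Lemma fg_mulrV : right_inverse fg_one fg_inv fg_mul.
Proof.
move=> u; apply: val_inj => /=.
by have := foldr_push_inv (inv_word u); rewrite inv_wordK.
Qed.

HB.instance Definition _ :=
  isGroup.Build free_group fg_mulA fg_mul1 fg_mulr1 fg_mulV fg_mulrV.

End FreeGroup.

Section HomeoGroup.
Variable T : topologicalType.

Record homeo : Type := Homeo {
  homeo_fun :> T -> T;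
  homeo_inv : T -> T;
  homeo_funK : cancel homeo_fun homeo_inv;
  homeo_invK : cancel homeo_inv homeo_fun;
  homeo_fun_continuous : continuous homeo_fun;
  homeo_inv_continuous : continuous homeo_inv }.

Lemma homeoP (f g : homeo) : homeo_fun f = homeo_fun g -> f = g.
Proof.
case: f g => [f f' fK Kf cf cf'] [g g' gK Kg cg cg'] /= fg; subst g.
have ff' : f' = g' by apply/funext => x; rewrite -[x in LHS]Kg fK.
by subst g'; congr Homeo; exact: Prop_irrelevance.
Qed.

HB.instance Definition _ := gen_eqMixin homeo.
HB.instance Definition _ := gen_choiceMixin homeo.

Definition homeo_one : homeo :=
  @Homeo idfun idfun (fun=> erefl) (fun=> erefl)
    (fun=> cvg_id) (fun=> cvg_id).

Definition homeo_mul (f g : homeo) : homeo.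
Proof.
refine (@Homeo (f \o g) (homeo_inv g \o homeo_inv f) _ _ _ _).
- exact: can_comp (@homeo_funK f) (@homeo_funK g).
- exact: can_comp (@homeo_invK g) (@homeo_invK f).
- move=> x; apply: continuous_comp; exact: homeo_fun_continuous.
- move=> x; apply: continuous_comp; exact: homeo_inv_continuous.
Defined.

Definition homeo_invg (f : homeo) : homeo :=
  Homeo (@homeo_invK f) (@homeo_funK f)
    (@homeo_inv_continuous f) (@homeo_fun_continuous f).

Lemma homeo_mulA : associative homeo_mul.
Proof. by move=> f g h; apply: homeoP. Qed.

Lemma homeo_mul1 : left_id homeo_one homeo_mul.
Proof. by move=> f; apply: homeoP. Qed.

Lemma homeo_mulr1 : right_id homeo_one homeo_mul.
Proof. by move=> f; apply: homeoP. Qed.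

Lemma homeo_mulV : left_inverse homeo_one homeo_invg homeo_mul.
Proof. by move=> f; apply: homeoP; apply/funext => x /=; rewrite homeo_funK. Qed.

Lemma homeo_mulrV : right_inverse homeo_one homeo_invg homeo_mul.
Proof. by move=> f; apply: homeoP; apply/funext => x /=; rewrite homeo_invK. Qed.

HB.instance Definition _ :=
  isGroup.Build homeo homeo_mulA homeo_mul1 homeo_mulr1 homeo_mulV homeo_mulrV.

End HomeoGroup.

Section Groups.
Variable G : groupType.

Definition is_subgroup (H : set G) : Prop := group_closed [in H].

Definition isomorphic_to_subgroup (L : groupType) (H : set G) : Prop :=
  exists phi : {multiplicative L -> G}, injective phi /\ range phi = H.

End Groups.

Section Simplices.
Variables (R : realType) (n : nat).
Local Notation V := 'rV[R]_n.

(* A simplex is represented by its finite vertex set. *)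
Definition conv_hull (s : {fset V}) : set V :=
  [set x | exists w : V -> R,
    [/\ {in s, forall v, 0 <= w v}, \sum_(v <- s) w v = 1 &
        x = \sum_(v <- s) w v *: v]].

Definition affinely_independent (s : {fset V}) : Prop :=
  forall w : V -> R,
    \sum_(v <- s) w v = 0 -> \sum_(v <- s) w v *: v = 0 ->
    {in s, forall v, w v = 0}.

Definition is_simplex (s : {fset V}) : Prop :=
  s != fset0 /\ affinely_independent s.

(* K is a finite geometric simplicial complex with underlying space A. *)
Definition is_subdivision (A : set V) (K : {fset {fset V}}) : Prop :=
  [/\ {in K, forall s, is_simplex s},
      {in K, forall s, forall t : {fset V},
        t != fset0 -> (t `<=` s)%fset -> t \in K},
      {in K &, forall s t,
        conv_hull s `&` conv_hull t = conv_hull (s `&` t)%fset} &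
      \bigcup_(s in [set` K]) conv_hull s = A].

End Simplices.

Section PLCube.
Variables (R : realType) (n : nat).

Definition cube : set 'rV[R]_n := [set x | forall i, 0 <= x ord0 i <= 1].

Definition agrees_with_affine (f : cube -> cube) (s : {fset 'rV[R]_n})
    (A : 'M[R]_n) (b : 'rV[R]_n) : Prop :=
  forall p : cube, conv_hull s (val p) -> val (f p) = val p *m A + b.

Definition piecewise_linear (f : cube -> cube) : Prop :=
  exists2 K : {fset {fset 'rV[R]_n}}, is_subdivision cube K &
    {in K, forall s, exists A b, agrees_with_affine f s A b}.

(* For piecewise linear homeomorphisms: wherever f is affine on a
   full-dimensional simplex, its linear part has positive determinant. *)
Definition orientation_preserving (f : cube -> cube) : Prop :=
  forall (s : {fset 'rV[R]_n}) (A : 'M[R]_n) (b : 'rV[R]_n),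
    is_simplex s -> #|` s| = n.+1 -> conv_hull s `<=` cube ->
    agrees_with_affine f s A b -> 0 < \det A.

Definition PL : set (homeo cube) :=
  [set f | piecewise_linear f /\ orientation_preserving f].

(* The vertical leaf {x} x I: the last coordinate is free. *)
Definition leaf (x : 'rV[R]_n.-1) : set cube :=
  [set p : cube | forall i : 'I_n.-1,
     (val p) ord0 (widen_ord (leq_pred n) i) = x ord0 i].

End PLCube.

Arguments cube : clear implicits.
Arguments PL : clear implicits.

(* The group PL(I^n, F), as a subset of the homeomorphism group of I^n. *)
Definition PLF (R : realType) (n : nat) : set (homeo (cube R n)) :=
  [set f | PL R n f /\
     forall x : 'rV[R]_n.-1, cube R n.-1 x -> f @` leaf x = leaf x].
Arguments PLF : clear implicits.

(* Main.v *)
Require Import Defs.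
From HB Require Import structures.
From mathcomp Require Import all_boot all_order all_algebra.
From mathcomp Require Import finmap.
From mathcomp Require Import all_classical all_reals topology.
From mathcomp Require Import normedtype realfun ring lra.

Set Implicit Arguments.
Unset Strict Implicit.
Unset Printing Implicit Defensive.

Import Order.TTheory GRing.Theory Num.Theory.
Import numFieldTopology.Exports.

Local Open Scope classical_set_scope.
Local Open Scope ring_scope.

(** On a single vertical leaf the group acts by piecewise linear homeomorphisms
of an interval, and such groups contain no free subgroup by a theorem of Brin
and Squier.  This is not enough by itself, since a free group embeds in a
product of groups without free subgroups: one needs a single leaf on which a
given free group acts faithfully.  Such a leaf need not exist in the cube, but
it exists among the limits of leaves along an ultrafilter.

Let a free group F of rank 2 act.  For each nontrivial w let N(w) be the set of
leaves that w moves.  These sets are nonempty, and N(v) and N(w) both contain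
N([v, w^k]), where k can be chosen such that the commutator is nontrivial.
Hence some ultrafilter U contains all the N(w), and F acts faithfully on the
ultraproduct of the leaves, whose points are the functions assigning to each
leaf a height on it, compared U-almost everywhere.  Since the simplices of a
subdivision are finitely many, each generator still has finitely many
breakpoints on this limit leaf: at each leaf they are 0, 1 and the tops of the
intersections of the leaf with the simplices.

The limit leaf is not complete, so the argument of Brin and Squier is phrased
with convex hulls of orbits instead of suprema.  On an orbit hull without
breakpoints, and close to either end of any orbit hull, all of F acts by affine
maps, so the second derived subgroup acts trivially there
([germless_fixes_off_breakpoints], [germless_fixes_end]).  An element w of the
second derived subgroup thus moves only points in the finitely many hulls that
contain breakpoints, and in each of them only points of a bounded interval.
Some h pushes this interval off itself, so [w, h w h^-1] is trivial on one hull
more than w is.  By induction on the number of hulls this commutator is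
trivial in F, for every h pushing far enough; as commutation is transitive in F,
w then commutes with all its conjugates, so that w = 1
([germless_trivial]).  Thus F would be metabelian, which it is not
([piecewise_affine_action_trivial]).

A leaf preserving homeomorphism is monotone on every leaf, so its square is
increasing on every leaf.  The action above is therefore that of the subgroup
generated by the squares of two free generators.  That this subgroup is free,
and the two facts on commutation in it, come from the matrices
[[1, 6], [0, 1]] and [[1, 0], [6, 1]] that represent these squares. *)

(** * Uniformly piecewise affine families *)

(** The same finite list of breakpoint functions has to serve for all omega: this
is what survives the passage to an ultraproduct.  The coefficients alpha and
beta may depend on the interval and on omega. *)
Definition piecewise_affine (R : realFieldType) (Omega : Type)
    (bs : seq (Omega -> R)) (h : Omega -> R -> R) : Prop :=
  forall omega s t, s <= t ->
    (forall b, b \in bs -> ~~ (s <= b omega <= t)) ->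
    exists alpha beta, forall u, s <= u <= t -> h omega u = alpha * u + beta.

Lemma filter_all_in (T : Type) (I : eqType) (F : set_system T) (r : seq I)
    (P : I -> set T) : Filter F ->
  (forall i, i \in r -> F (P i)) -> F [set x | forall i, i \in r -> P i x].
Proof.
move=> FF; elim: r => [|i r IH] FP.
  by apply: filterS filterT => x _ j; rewrite in_nil.
have FPi := FP i (mem_head _ _).
have FPr := IH (fun j jr => FP j (mem_behead (s := i :: r) jr)).
apply: filterS2 FPi FPr => x Pi Pr j.
by rewrite in_cons => /predU1P[->|/Pr].
Qed.

(** * The limit leaf along an ultrafilter *)

Section Hyperleaf.
Variables (R : realFieldType) (Omega : Type) (G : groupType).
Variable act : G -> Omega -> R -> R.
Hypothesis act1 : forall omega t, act 1%g omega t = t.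
Hypothesis actM : forall g h omega t,
  act (g * h)%g omega t = act g omega (act h omega t).
Hypothesis act_mono : forall g omega, {mono act g omega : s t / s <= t}.
Variable U : set_system Omega.
Hypothesis U_ultra : UltraFilter U.

Local Notation X := (Omega -> R).

Let U_filter : Filter U.
Proof. by case: U_ultra => -[]. Qed.
Local Existing Instance U_filter.

Let UI A B : U A -> U B -> U (A `&` B).
Proof. exact: filterI. Qed.

(** The points of the limit leaf are functions Omega -> R up to [eqU].  No quotient
is formed: every property below is compatible with [eqU], and it is enough that
[leU] is a total preorder. *)
Definition leU (s t : X) : Prop := U [set omega | s omega <= t omega].
Definition eqU (s t : X) : Prop := U [set omega | s omega = t omega].
Definition actX (g : G) (t : X) : X := fun omega => act g omega (t omega).

Lemma leUxx s : leU s s.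
Proof. by apply: filterS filterT => omega _ /=. Qed.

Lemma leU_trans s t u : leU s t -> leU t u -> leU s u.
Proof. by apply: filterS2 => omega /=; exact: le_trans. Qed.

Lemma leU_total s t : leU s t \/ leU t s.
Proof.
have [|] := in_ultra_setVsetC [set omega | s omega <= t omega] U_ultra.
  by left.
by move=> nst; right; apply: filterS nst => omega /= /negP; rewrite -ltNge => /ltW.
Qed.

Lemma leU_anti s t : leU s t -> leU t s -> eqU s t.
Proof.
by apply: filterS2 => omega /= st ts; apply/eqP; rewrite eq_le st ts.
Qed.

Lemma eqUW s t : eqU s t -> leU s t.
Proof. by apply: filterS => omega /= ->. Qed.

Lemma eqU_sym s t : eqU s t -> eqU t s.
Proof. by apply: filterS => omega /= ->. Qed.

Lemma eqU_trans s t u : eqU s t -> eqU t u -> eqU s u.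
Proof. by apply: filterS2 => omega /= ->. Qed.

Lemma actX1 t : actX 1%g t = t.
Proof. by apply/funext => omega; exact: act1. Qed.

Lemma actXM g h t : actX (g * h)%g t = actX g (actX h t).
Proof. by apply/funext => omega; exact: actM. Qed.

Lemma actXK g t : actX g^-1%g (actX g t) = t.
Proof. by rewrite -actXM mulVg actX1. Qed.

Lemma actXKV g t : actX g (actX g^-1%g t) = t.
Proof. by rewrite -actXM mulgV actX1. Qed.

Lemma leU_actX g s t : leU s t -> leU (actX g s) (actX g t).
Proof. by apply: filterS => omega /=; rewrite act_mono. Qed.

Lemma eqU_actX g s t : eqU s t -> eqU (actX g s) (actX g t).
Proof. by apply: filterS => omega /=; rewrite /actX => ->. Qed.

Lemma leU_actXV g s t : leU (actX g s) t -> leU s (actX g^-1%g t).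
Proof. by move/(leU_actX g^-1%g); rewrite actXK. Qed.

Lemma leU_actXVr g s t : leU s (actX g t) -> leU (actX g^-1%g s) t.
Proof. by move/(leU_actX g^-1%g); rewrite actXK. Qed.

Definition fixes (w : G) (t : X) : Prop := eqU (actX w t) t.

Lemma fixesM g h t : fixes g t -> fixes h t -> fixes (g * h)%g t.
Proof.
by move=> gt ht; rewrite /fixes actXM; apply: eqU_trans gt; exact: eqU_actX.
Qed.

Lemma fixesV g t : fixes g t -> fixes g^-1%g t.
Proof.
move=> gt; apply: eqU_sym; rewrite /fixes -[X in eqU X _](actXK g).
exact: eqU_actX.
Qed.

Lemma fixesJ g h t : fixes g (actX h t) -> fixes (g ^ h)%g t.
Proof.
move=> gt; rewrite /fixes conjgE !actXM -[X in eqU _ X](actXK h).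
exact: eqU_actX.
Qed.

Lemma fixes_eqU g s t : eqU s t -> fixes g s -> fixes g t.
Proof.
move=> st gs; have gts := eqU_actX g (eqU_sym st).
exact: eqU_trans (eqU_trans gts gs) st.
Qed.

Lemma fixesR g h t : eqU (actX g (actX h t)) (actX h (actX g t)) ->
  fixes [~ g, h]%g t.
Proof.
move=> ght; rewrite /fixes commgEl conjgE !actXM.
rewrite -[X in eqU _ X](actXK g) -[X in eqU _ (actX _ X)](actXK h).
by do 2!apply: eqU_actX.
Qed.

(** * Germs along invariant filters *)

Definition invariant (E : set_system X) : Prop :=
  forall g A, E A -> E (actX g @^-1` A).

Definition affine_near (E : set_system X) (g : G) : Prop :=
  exists alpha beta : X, E [set t |
    eqU (actX g t) (fun omega => alpha omega * t omega + beta omega)].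

Definition shift_near (E : set_system X) (g : G) : Prop :=
  exists gamma : X, E [set t |
    eqU (actX g t) (fun omega => t omega + gamma omega)].

Definition fix_near (E : set_system X) (g : G) : Prop :=
  E [set t | fixes g t].

Section Germs.
Variable E : set_system X.
Hypothesis E_filter : Filter E.
Hypothesis E_inv : invariant E.

Let EI A B : E A -> E B -> E (A `&` B).
Proof. exact: filterI. Qed.

Lemma affine_near1 : affine_near E 1%g.
Proof.
exists (cst 1), (cst 0); apply: filterS filterT => t _.
by apply: filterS filterT => omega _ /=; rewrite actX1 /cst mul1r addr0.
Qed.

Lemma affine_nearM g h :
  affine_near E g -> affine_near E h -> affine_near E (g * h)%g.
Proof.
move=> [a [b gE]] [c [d hE]].
exists (fun omega => a omega * c omega), (fun omega => a omega * d omega + b omega).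
apply: filterS2 (E_inv h gE) hE => t /= gt ht; rewrite actXM.
by apply: filterS2 gt ht => omega /= -> ->; ring.
Qed.

(** The two composites of the affine maps of g^-1 and h^-1 have the same slope, hence
differ by a constant; the commutator carries one composite to the other. *)
Lemma shift_nearR g h : affine_near E g^-1%g -> affine_near E h^-1%g ->
  shift_near E [~ g, h]%g.
Proof.
move=> [a [b gE]] [c [d hE]].
exists (fun omega => a omega * d omega + b omega - (c omega * b omega + d omega)).
(* the commutator is evaluated at the points s = h^-1 (g^-1 t) *)
have ghE := EI (EI gE (E_inv g^-1%g hE)) (EI hE (E_inv h^-1%g gE)).
apply: filterS (E_inv (g * h)%g ghE) => s /=.
set t := actX (g * h)%g s => -[[gt hgt] [ht ght]].
have -> : s = actX h^-1%g (actX g^-1%g t) by rewrite /t actXM !actXK.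
have -> : actX [~ g, h]%g (actX h^-1%g (actX g^-1%g t)) =
          actX g^-1%g (actX h^-1%g t).
  by rewrite -!actXM commgEl conjgE !mulgA !mulgK.
apply: filterS2 (UI gt hgt) (UI ht ght) => omega /=.
by move=> [gt' ->] [ht' ->]; rewrite gt' ht'; ring.
Qed.

Lemma fix_nearR g h : shift_near E g -> shift_near E h ->
  fix_near E [~ g, h]%g.
Proof.
move=> [b gE] [d hE].
apply: filterS2 (EI gE (E_inv g hE)) (EI hE (E_inv h gE)) => t /=.
move=> [gt hgt] [ht ght]; apply: fixesR.
apply: filterS2 (UI gt hgt) (UI ht ght) => omega /=.
by move=> [gt' ->] [ht' ->]; rewrite gt' ht'; ring.
Qed.

End Germs.

(** * Affine behaviour off the breakpoints *)

Definition convexU (D : set X) : Prop :=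
  forall s t u, D s -> D t -> leU s u -> leU u t -> D u.

Lemma convexU_min D s t : convexU D -> D s -> D t ->
  D (fun omega => Num.min (s omega) (t omega)).
Proof.
move=> Dconv Ds Dt; have [st|ts] := leU_total s t.
  apply: (Dconv s s) => //; apply: filterS st => omega /= st.
    by rewrite le_min lexx.
  by rewrite ge_min lexx.
apply: (Dconv t t) => //; apply: filterS ts => omega /= ts.
  by rewrite le_min ts lexx.
by rewrite ge_min lexx orbT.
Qed.

Lemma convexU_max D s t : convexU D -> D s -> D t ->
  D (fun omega => Num.max (s omega) (t omega)).
Proof.
move=> Dconv Ds Dt; have [st|ts] := leU_total s t.
  apply: (Dconv t t) => //; apply: filterS st => omega /= st.
    by rewrite le_max lexx orbT.
  by rewrite ge_max st lexx.
apply: (Dconv s s) => //; apply: filterS ts => omega /= ts.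
  by rewrite le_max lexx.
by rewrite ge_max ts lexx.
Qed.

(** If D has two distinct points, then at almost every omega they determine an affine
map.  It is the map that h follows on D, because for each third point of D almost
every omega has no breakpoint between the three points: otherwise, U being an
ultrafilter, a breakpoint function would lie in D by convexity. *)
Lemma affine_on_gap (bs : seq X) (h : Omega -> R -> R) (D : set X) :
  piecewise_affine bs h -> convexU D -> (forall b, b \in bs -> ~ D b) ->
  exists alpha beta : X, forall t, D t ->
    eqU (fun omega => h omega (t omega))
        (fun omega => alpha omega * t omega + beta omega).
Proof.
move=> h_aff Dconv Dbs.
have [[s0 [t0 [Ds Dt nts]]]|Dsub] :=
  pselect (exists s0 t0, [/\ D s0, D t0 & ~ leU t0 s0]).
  pose a omega := (h omega (t0 omega) - h omega (s0 omega)) / (t0 omega - s0 omega).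
  exists a, (fun omega => h omega (s0 omega) - a omega * s0 omega) => t Dt1.
  pose lo omega := Num.min (s0 omega) (t omega).
  pose hi omega := Num.max (t0 omega) (t omega).
  have Dlo : D lo by exact: convexU_min.
  have Dhi : D hi by exact: convexU_max.
  have lt0 : U [set omega | s0 omega < t0 omega].
    have [//|] := in_ultra_setVsetC [set omega | t0 omega <= s0 omega] U_ultra.
    by apply: filterS => omega /= /negP; rewrite -ltNge.
  have gap : U [set omega | forall b, b \in bs -> ~~ (lo omega <= b omega <= hi omega)].
    apply: filter_all_in => b bbs.
    have [lbh|] := in_ultra_setVsetC
      [set omega | lo omega <= b omega <= hi omega] U_ultra.
      case: (Dbs b bbs); apply: (Dconv lo hi) => //.
        by apply: filterS lbh => omega /= /andP[].
      by apply: filterS lbh => omega /= /andP[].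
    by apply: filterS => omega /= /negP.
  apply: filterS2 lt0 gap => omega /= lts gapo.
  have [|al [be aff]] := h_aff omega (lo omega) (hi omega) _ gapo.
    by rewrite /lo /hi ge_min le_max (ltW lts).
  have hs : h omega (s0 omega) = al * s0 omega + be.
    by apply: aff; rewrite /lo /hi ge_min lexx le_max (ltW lts).
  have ht : h omega (t0 omega) = al * t0 omega + be.
    by apply: aff; rewrite /lo /hi ge_min (ltW lts) le_max lexx.
  rewrite aff; last by rewrite /lo /hi ge_min le_max !lexx !orbT.
  have dn : t0 omega - s0 omega != 0 by rewrite subr_eq0 gt_eqF.
  have -> : a omega = al by rewrite /a ht hs; field.
  by rewrite hs; ring.
have [[s Ds]|D0] := pselect (exists s, D s); last first.
  by exists (cst 0), (cst 0) => t Dt; case: D0; exists t.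
exists (cst 0), (fun omega => h omega (s omega)) => t Dt.
have tU : eqU t s.
  by apply: leU_anti; apply: contrapT => n; apply: Dsub; [exists s, t|exists t, s].
by apply: filterS tU => omega /= ->; rewrite /cst mul0r add0r.
Qed.

(** * Convex hulls of orbits and their ends *)

Definition hull (b : X) : set X :=
  [set s | exists g h, leU (actX g b) s /\ leU s (actX h b)].

Lemma hull_refl b : hull b b.
Proof. by exists 1%g, 1%g; rewrite actX1; split; exact: leUxx. Qed.

Lemma hull_convex b : convexU (hull b).
Proof.
move=> s t u [g [_ [gs _]]] [_ [h [_ ht]]] su ut.
by exists g, h; split; [exact: leU_trans su|exact: leU_trans ht].
Qed.

Lemma hull_act b k s : hull b s -> hull b (actX k s).
Proof.
by move=> [g [h [gs sh]]]; exists (k * g)%g, (k * h)%g; rewrite !actXM; split;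
  exact: leU_actX.
Qed.

Lemma hull_sym b s : hull b s -> hull s b.
Proof.
by move=> [g [h [gs sh]]]; exists h^-1%g, g^-1%g; split;
  [exact: leU_actXVr|exact: leU_actXV].
Qed.

Lemma hull_escape b s t : hull b s -> hull b t ->
  exists h, leU t (actX h s).
Proof.
move=> [g [_ [gs _]]] [_ [h [_ th]]]; exists (h * g^-1)%g.
by apply: leU_trans th _; rewrite actXM; apply/leU_actX/leU_actXV.
Qed.

(** The order or its reverse, so that both ends of a hull are treated at once. *)
Definition ahead (d : bool) (s t : X) : Prop := if d then leU s t else leU t s.

Lemma ahead_refl d s : ahead d s s.
Proof. by case: d; exact: leUxx. Qed.

Lemma ahead_trans d s t u : ahead d s t -> ahead d t u -> ahead d s u.
Proof. by case: d => /= st tu; [exact: leU_trans st tu|exact: leU_trans tu st]. Qed.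

Lemma ahead_total d s t : ahead d s t \/ ahead d t s.
Proof. by case: d; exact: leU_total. Qed.

Lemma ahead_anti d s t : ahead d s t -> ahead d t s -> eqU s t.
Proof. by case: d => /= st ts; exact: leU_anti. Qed.

Lemma ahead_actX d g s t : ahead d s t -> ahead d (actX g s) (actX g t).
Proof. by case: d; exact: leU_actX. Qed.

(** The part of the hull strictly past u: these sets form a base of the filter of
neighbourhoods of one end of the hull. *)
Definition beyond (b : X) (d : bool) (u : X) : set X :=
  [set t | hull b t /\ ~ ahead d t u].

Lemma beyond_sub b d u v t : ahead d u v -> beyond b d v t -> beyond b d u t.
Proof.
by move=> uv [bt ntv]; split => // tu; apply: ntv; exact: ahead_trans uv.
Qed.

Lemma beyond_convex b d u : convexU (beyond b d u).
Proof.
move=> s t v [bs ns] [bt nt] sv vt; split; first exact: hull_convex sv vt.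
case: d ns nt => /= ns nt vu.
  by apply: ns; exact: leU_trans vu.
by apply: nt; exact: leU_trans vt.
Qed.

Definition end_filter (b : X) (d : bool) : set_system X :=
  [set A | exists2 u, hull b u & beyond b d u `<=` A].

Lemma end_filter_filter b d : Filter (end_filter b d).
Proof.
split.
- by exists b => //; exact: hull_refl.
- move=> A B [u bu uA] [v bv vB]; have [uv|vu] := ahead_total d u v.
    exists v => // t vt; split; last exact: vB.
    by apply: uA; exact: beyond_sub vt.
  exists u => // t ut; split; first exact: uA.
  by apply: vB; exact: beyond_sub ut.
- by move=> A B AB [u bu uA]; exists u => //; exact: subset_trans AB.
Qed.

Lemma end_filter_invariant b d : invariant (end_filter b d).
Proof.
move=> g A [u bu uA]; exists (actX g^-1%g u); first exact: hull_act.
move=> t [bt nt]; apply: uA; split; first exact: hull_act.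
by move=> gtu; apply: nt; rewrite -[t](actXK g); exact: ahead_actX.
Qed.

Lemma hull_last (bs : seq X) b d :
  exists2 u, hull b u & forall c, c \in bs -> hull b c -> ahead d c u.
Proof.
elim: bs => [|c bs [u bu IH]]; first by exists b => //; exact: hull_refl.
have [[bc uc]|nc] := pselect (hull b c /\ ahead d u c).
  exists c => // e; rewrite in_cons => /predU1P[->|ebs be].
    by move=> _; exact: ahead_refl.
  by apply: ahead_trans uc; exact: IH.
exists u => // e; rewrite in_cons => /predU1P[->|]; last exact: IH.
by move=> bc; have [//|uc] := ahead_total d c u; case: nc.
Qed.

(** * Elements without germs *)

Section PiecewiseAffineGenerators.
Variables (gens : seq G) (bs : seq X).
Hypothesis gens_ind : forall P : G -> Prop, P 1%g ->
  (forall g, g \in gens -> P g) ->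
  (forall g h, P g -> P h -> P (g * h)%g) -> forall g, P g.
Hypothesis gens_affine : forall g, g \in gens -> piecewise_affine bs (act g).

(** The property of the second derived subgroup that the induction uses; it passes
from w to [~ w, w ^ h]. *)
Definition germless (w : G) : Prop :=
  forall E : set_system X, Filter E -> invariant E ->
    (forall g, g \in gens -> affine_near E g) -> fix_near E w.

Lemma germlessRR (x y z t : G) : germless [~ [~ x, y], [~ z, t]]%g.
Proof.
move=> E Ef Ei Eg.
have aff : forall g, affine_near E g.
  apply: gens_ind Eg _; first exact: affine_near1.
  by move=> g h; exact: affine_nearM.
by apply: fix_nearR => //; exact: shift_nearR.
Qed.

Lemma germlessV w : germless w -> germless w^-1%g.
Proof. by move=> gw E Ef Ei Eg; apply: filterS (gw E Ef Ei Eg); exact: fixesV. Qed.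

Lemma germlessM v w : germless v -> germless w -> germless (v * w)%g.
Proof.
move=> gv gw E Ef Ei Eg; apply: filterS2 (gv E Ef Ei Eg) (gw E Ef Ei Eg).
exact: fixesM.
Qed.

Lemma germlessJ w h : germless w -> germless (w ^ h)%g.
Proof.
move=> gw E Ef Ei Eg; apply: filterS (Ei h _ (gw E Ef Ei Eg)) => t.
exact: fixesJ.
Qed.

Lemma germlessR v w : germless v -> germless w -> germless [~ v, w]%g.
Proof.
by move=> gv gw; apply: germlessM; [exact: germlessV|exact: germlessJ].
Qed.

(** Past the last breakpoint of a hull in a given direction there is no breakpoint
left, so the end filter sees only affine maps. *)
Lemma affine_near_end b d g : g \in gens -> affine_near (end_filter b d) g.
Proof.
move=> /gens_affine gaff; have [u bu ulast] := hull_last bs b d.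
have [|al [be aff]] := affine_on_gap gaff (beyond_convex (b := b) (d := d) (u := u)).
  by move=> c cbs [bc]; apply; exact: ulast.
by exists al, be; exists u.
Qed.

(** The end filter says nothing about u itself.  One replaces u by a point strictly
further; if there is none, u is an extremal point of the hull and the whole group
fixes it. *)
Lemma germless_fixes_end w b d : germless w ->
  exists2 u, hull b u &
    forall t, hull b t -> ahead d u t -> fixes w t.
Proof.
move=> gw.
have [u bu ufix] : fix_near (end_filter b d) w.
  apply: gw; [exact: end_filter_filter|exact: end_filter_invariant|].
  by move=> g; exact: affine_near_end.
have [[v uv]|nv] := pselect (exists v, beyond b d u v).
  exists v; first by case: uv.
  move=> t bt vt; apply: ufix; split => // tu; case: uv => _; apply.
  exact: ahead_trans tu.
have umax t : hull b t -> ahead d t u.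
  by move=> bt; apply: contrapT => ntu; apply: nv; exists t.
exists u => // t bt ut; apply: (@fixes_eqU w u); last first.
  apply: (@ahead_anti d); first exact/umax/hull_act.
  rewrite -[X in ahead _ X _](actXKV w); apply: ahead_actX.
  exact/umax/hull_act.
by apply: (@ahead_anti d) => //; exact: umax.
Qed.

(** Here the invariant filter consists of the sets containing the whole hull. *)
Lemma germless_fixes_off_breakpoints w t : germless w ->
  (forall b, b \in bs -> ~ hull t b) -> fixes w t.
Proof.
move=> gw nbs.
pose E : set_system X := [set A | hull t `<=` A].
suff : fix_near E w by apply; exact: hull_refl.
apply: gw.
- by move=> g A tA s ts; apply: tA; exact: hull_act.
- move=> g /gens_affine gaff.
  have [al [be aff]] := affine_on_gap gaff (hull_convex (b := t)) nbs.
  by exists al, be.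
Qed.

Definition fixes_hull (w : G) (b : X) : Prop := forall t, hull b t -> fixes w t.

Lemma germless_fixes_all w : germless w ->
  (forall b, b \in bs -> fixes_hull w b) -> forall t, fixes w t.
Proof.
move=> gw wbs t.
have [[b [bbs tb]]|n] := pselect (exists b, b \in bs /\ hull t b).
  by apply: (wbs b) => //; exact: hull_sym.
by apply: germless_fixes_off_breakpoints => // b bbs tb; apply: n; exists b.
Qed.

(** In the hull, w moves only points between lo and hi, hence its conjugate by h^-1
moves only points between h lo and h hi, all above hi. *)
Lemma displaced_commute w b lo hi h :
  hull b lo -> hull b hi ->
  (forall t, hull b t -> leU t lo -> fixes w t) ->
  (forall t, hull b t -> leU hi t -> fixes w t) ->
  leU hi (actX h lo) -> fixes_hull [~ w, w ^ h^-1]%g b.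
Proof.
move=> blo bhi wlo whi hih t bt; set v := (w ^ h^-1)%g.
have vfix s : hull b s -> leU s (actX h lo) -> fixes v s.
  by move=> bs' sh; apply: fixesJ; apply: wlo; [exact: hull_act|exact: leU_actXVr].
apply: fixesR; have [th|ht] := leU_total t hi.
  have vt : fixes v t by apply: vfix => //; exact: leU_trans hih.
  have vwt : fixes v (actX w t).
    apply: vfix; first exact: hull_act.
    apply: leU_trans (leU_actX w th) _.
    by apply: leU_trans hih; apply/eqUW/whi => //; exact: leUxx.
  by apply: (eqU_trans (eqU_actX w vt)); exact: eqU_sym.
have wt : fixes w t by exact: whi.
have wvt : fixes w (actX v t).
  apply: whi; first exact: hull_act.
  apply: leU_trans (leU_actX v ht).
  by apply/eqUW/eqU_sym/vfix.
by apply: (eqU_trans wvt); apply/eqU_actX/eqU_sym.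
Qed.

(** * The Brin-Squier induction *)

Hypothesis actX_faithful : forall w, (forall t, fixes w t) -> w = 1%g.
Hypothesis commute_trans : forall x y z : G, x != 1%g ->
  commute x y -> commute x z -> commute y z.
Hypothesis no_abelian_normal : forall w : G,
  (forall k, commute w (w ^ k)%g) -> w = 1%g.

(** L lists breakpoints whose hulls may still be moved by w.  For b at the head of L
and every h pushing lo above hi, the commutator of w and h w h^-1 is trivial on
the hull of b as well, hence trivial in G by induction.  Given any k, some h is
such that both h and h k push far enough; transitivity then makes h w h^-1 and
(h k) w (h k)^-1 commute, that is, w commutes with k w k^-1. *)
Lemma germless_trivial (L : seq X) w : germless w ->
  (forall b, b \in bs -> b \in L \/ fixes_hull w b) -> w = 1%g.
Proof.
elim: L w => [|b L IH] w gw wbs.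
  apply/actX_faithful/germless_fixes_all => // b /wbs[|//].
  by rewrite in_nil.
have [hi bhi whi] := @germless_fixes_end w b true gw.
have [lo blo wlo] := @germless_fixes_end w b false gw.
have comm_far h : leU hi (actX h lo) -> commute w (w ^ h^-1)%g.
  move=> hih; apply/commgP/eqP/IH.
    by apply: germlessR => //; exact: germlessJ.
  move=> c cbs; case: (wbs c cbs) => [|cfix].
    rewrite in_cons => /predU1P[->|]; last by left.
    by right; exact: displaced_commute hih.
  (* where w is trivial on an invariant set, so is its conjugate *)
  right=> t ct; apply: fixesR.
  have wt : fixes w t by exact: cfix.
  have vt : fixes (w ^ h^-1)%g t by apply/fixesJ/cfix/hull_act.
  apply: eqU_trans (eqU_trans (eqU_actX w vt) wt) _.
  by apply/eqU_sym; exact: eqU_trans (eqU_actX _ wt) vt.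
have [->//|w1] := eqVneq w 1%g.
apply: no_abelian_normal => k'; rewrite -[k']invgK; set k := k'^-1%g.
(* h must send the smaller of lo and k lo above hi *)
have [h [h_lo h_klo]] :
    exists h, leU hi (actX h lo) /\ leU hi (actX (h * k)%g lo).
  have bklo : hull b (actX k lo) by exact: hull_act.
  have [lok|klo] := leU_total lo (actX k lo).
    have [h hh] := hull_escape blo bhi; exists h; split => //.
    by apply: leU_trans hh _; rewrite actXM; exact: leU_actX.
  have [h hh] := hull_escape bklo bhi; exists h; split.
    by apply: leU_trans hh _; exact: leU_actX.
  by rewrite actXM.
have := commute_trans w1 (comm_far h h_lo) (comm_far _ h_klo).
rewrite invgM conjgM => /commgP; rewrite -conjRg conjg_eq1 => /commgP.
by [].
Qed.

Lemma metabelian_of_germs (x y z t : G) : [~ [~ x, y], [~ z, t]]%g = 1%g.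
Proof.
apply: (@germless_trivial bs); first exact: germlessRR.
by move=> b; left.
Qed.

End PiecewiseAffineGenerators.
End Hyperleaf.

(** The sets of leaves moved by the nontrivial elements generate a proper filter,
because two nontrivial elements v, w always have a nontrivial commutator
[~ v, w ^ k]: otherwise all conjugates of w commute with v, hence with w by
transitivity, and w is trivial.  An ultrafilter containing them all makes the action on the
limit leaf faithful, so G is metabelian; then [~ x, y] commutes with its
conjugates and is trivial, and the same argument applies to all elements of the
abelian group G. *)
Theorem piecewise_affine_action_trivial (R : realFieldType) (Omega : Type)
    (G : groupType) (act : G -> Omega -> R -> R) (gens : seq G)
    (bs : seq (Omega -> R)) :
  (forall omega t, act 1%g omega t = t) ->
  (forall g h omega t, act (g * h)%g omega t = act g omega (act h omega t)) ->
  (forall g omega, {mono act g omega : s t / s <= t}) ->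
  (forall w, (forall omega t, act w omega t = t) -> w = 1%g) ->
  (forall P : G -> Prop, P 1%g -> (forall g, g \in gens -> P g) ->
     (forall g h, P g -> P h -> P (g * h)%g) -> forall g, P g) ->
  (forall g, g \in gens -> piecewise_affine bs (act g)) ->
  (forall x y z : G, x != 1%g -> commute x y -> commute x z -> commute y z) ->
  (forall w : G, (forall k, commute w (w ^ k)%g) -> w = 1%g) ->
  forall w : G, w = 1%g.
Proof.
move=> act1 actM act_mono act_faithful gens_ind gens_aff ctrans noab.
suff metabelian (x y z t : G) : [~ [~ x, y], [~ z, t]]%g = 1%g.
  have abelian (x y : G) : commute x y.
    by apply/commgP/eqP/noab => k; rewrite conjRg; exact/commgP/eqP/metabelian.
  by move=> w; apply: noab => k; exact: abelian.
have [//|w0_neq1] := eqVneq [~ [~ x, y], [~ z, t]]%g 1%g.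
pose moved w : set Omega := [set omega | exists t, act w omega t != t].
pose F : set_system Omega := [set A | exists2 w, w != 1%g & moved w `<=` A].
have moved_ex w : w != 1%g -> moved w !=set0.
  move=> w1; apply: contrapT => nw; move/eqP: w1; apply; apply: act_faithful.
  move=> omega s; apply: contrapT => ws; apply: nw; exists omega, s.
  exact/eqP.
have act_fixV w omega : ~ moved w omega -> forall s, act w^-1%g omega s = s.
  move=> nw s; have ws u : act w omega u = u.
    by apply: contrapT => /eqP wu; apply: nw; exists u.
  by rewrite -[in LHS](ws s) -actM mulVg act1.
have act_fix w omega : ~ moved w omega -> forall s, act w omega s = s.
  by move=> nw s; apply: contrapT => /eqP ws; apply: nw; exists s.
have actR a b omega s : act [~ a, b]%g omega s =
    act a^-1%g omega (act b^-1%g omega (act a omega (act b omega s))).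
  by rewrite commgEl conjgE !actM.
have FF : ProperFilter F.
  split; first by move=> [w w1 w0]; have [omega] := moved_ex w w1; exact: w0.
  split.
  - by exists [~ [~ x, y], [~ z, t]]%g.
  - move=> A B [v v1 vA] [w w1 wB].
    have [k vwk] : exists k, ~ commute v (w ^ k)%g.
      apply: contrapT => nk; move/eqP: w1; apply; apply: noab => k.
      have vwk j : commute v (w ^ j)%g.
        by apply: contrapT => nj; apply: nk; exists j.
      by apply: (ctrans v) => //; rewrite -[w in commute _ w]conjg1.
    exists [~ v, w ^ k]%g; first by apply/negP => /commgP.
    move=> omega [s vws]; split.
      apply: vA; apply: contrapT => nv; move/eqP: vws; apply.
      by rewrite actR (act_fixV v) // (act_fix v) // -actM mulVg act1.
    apply: wB; apply: contrapT => nw; move/eqP: vws; apply.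
    have wk u : act (w ^ k)%g omega u = u.
      by rewrite conjgE !actM (act_fix w) // -actM mulVg act1.
    have wkV u : act (w ^ k)^-1%g omega u = u.
      by rewrite -[in LHS](wk u) -actM mulVg act1.
    by rewrite actR wk wkV -actM mulVg act1.
  - by move=> A B AB [w w1 wA]; exists w => //; exact: subset_trans AB.
have [U [U_ultra FU]] := ultraFilterLemma FF.
apply: (metabelian_of_germs act1 actM act_mono U_ultra gens_ind gens_aff) => //.
move=> w wfix; apply: contrapT => /eqP w1.
have Uw : U (moved w) by apply: FU; exists w.
have /choice[s ws] omega : exists r, moved w omega -> act w omega r != r.
  by have [[r wr]|nw] := pselect (moved w omega); [exists r|exists 0].
case: U_ultra => Up _; have [omega [ws1 ws2]] := filter_ex (filterI Uw (wfix s)).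
by move/eqP: (ws _ ws1); apply.
Qed.

(** * Evaluation of words of a free group *)

Section FreeGroupEvaluation.
Variables (S : choiceType) (T : Type) (idx : T) (op : Monoid.law idx).
Variable f : S * bool -> T.
Hypothesis f_inv : forall x, op (f x) (f (inv_letter x)) = idx.

Lemma big_push x w :
  \big[op/idx]_(y <- push x w) f y = op (f x) (\big[op/idx]_(y <- w) f y).
Proof.
case: w => [|y w] /=; first by rewrite big_seq1 big_nil Monoid.mulm1.
case: eqVneq => [->|_]; last by rewrite big_cons.
rewrite big_cons Monoid.mulmA -[LHS](Monoid.mul1m op).
congr (op _ _); exact/esym/f_inv.
Qed.

Lemma big_fg_mul (u v : free_group S) :
  \big[op/idx]_(y <- (u * v)%g) f y =
  op (\big[op/idx]_(y <- u) f y) (\big[op/idx]_(y <- v) f y).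
Proof.
have -> : (u * v)%g = foldr (@push S) v u :> seq _ by [].
elim: (fg_word u) => /= [|x w IH]; first by rewrite big_nil Monoid.mul1m.
by rewrite big_push IH big_cons Monoid.mulmA.
Qed.

End FreeGroupEvaluation.

Definition fg_letter (S : choiceType) (x : S * bool) : free_group S :=
  @FreeGroup S [:: x] isT.

Lemma fg_letter_inv (S : choiceType) (x : S * bool) :
  (fg_letter x * fg_letter (inv_letter x))%g = 1%g.
Proof. by apply: val_inj; rewrite /= eqxx. Qed.

Lemma fg_word_eq1 (S : choiceType) (w : free_group S) :
  (w == 1%g) = (fg_word w == [::]).
Proof. by rewrite -(inj_eq val_inj). Qed.

Lemma fg_letter_ind (S : choiceType) (P : free_group S -> Prop) : P 1%g ->
  (forall x, P (fg_letter x)) -> (forall g h, P g -> P h -> P (g * h)%g) ->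
  forall g, P g.
Proof.
move=> P1 Px PM [w wred].
elim: w wred => [|x w IH] wred.
  by rewrite (_ : FreeGroup _ = 1%g) //; apply: val_inj.
have wred' : reduced w by exact: path_sorted wred.
have -> : FreeGroup wred = (fg_letter x * FreeGroup wred')%g.
  apply: val_inj => /=; case: w wred {IH wred'} => [|y w] //= /andP[yx _].
  by rewrite (negbTE yx).
by apply: PM => //; exact: IH.
Qed.

(** * Commuting 2x2 matrices *)

Lemma mulmx2E (K : pzRingType) (A B : 'M[K]_2) i j :
  (A * B) i j = A i 0 * B 0 j + A i 1 * B 1 j.
Proof.
rewrite mxE !big_ord_recl big_ord0 addr0.
by have -> : lift ord0 ord0 = 1 :> 'I_2 by exact: val_inj.
Qed.

Lemma matrix2P (K : Type) (A B : 'M[K]_2) :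
  A 0 0 = B 0 0 -> A 0 1 = B 0 1 -> A 1 0 = B 1 0 -> A 1 1 = B 1 1 -> A = B.
Proof.
move=> e00 e01 e10 e11; apply/matrixP => i j.
have ord2 (k : 'I_2) : k = 0 \/ k = 1.
  by case: k => [[|[|k]] // lk]; [left|right]; exact: val_inj.
by case: (ord2 i) => ->; case: (ord2 j) => ->.
Qed.


Definition parallel (u v : int * int * int) : Prop :=
  [/\ u.1.1 * v.1.2 = v.1.1 * u.1.2,
      u.1.2 * v.2 = v.1.2 * u.2 &
      u.2 * v.1.1 = v.2 * u.1.1].

Lemma parallel_trans u v w : u != 0 -> parallel u v -> parallel u w ->
  parallel v w.
Proof.
have cyc (a b c a1 b1 c1 a2 b2 c2 : int) : a != 0 ->
    a * b1 = a1 * b -> c * a1 = c1 * a -> a * b2 = a2 * b -> c * a2 = c2 * a ->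
    [/\ a1 * b2 = a2 * b1, b1 * c2 = b2 * c1 & c1 * a2 = c2 * a1].
  move=> a0 ab1 ca1 ab2 ca2; split; first 2 last.
  - by apply: (mulfI a0); have := congr1 ( *%R a2) ca1;
      have := congr1 ( *%R a1) ca2; lra.
  - by apply: (mulfI a0); have := congr1 ( *%R a2) ab1;
      have := congr1 ( *%R a1) ab2; lra.
  have -> : b1 * c2 = b2 * c1; last by [].
  apply: (mulfI a0); apply: (mulfI a0).
  have -> : a * (a * (b1 * c2)) = (a * b1) * (c2 * a) by ring.
  have -> : a * (a * (b2 * c1)) = (a * b2) * (c1 * a) by ring.
  by rewrite ab1 ab2 -ca1 -ca2; ring.
case: u v w => [[a b] c] [[a1 b1] c1] [[a2 b2] c2].
rewrite /parallel /= => u0 [e1 e2 e3] [f1 f2 f3].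
have [a0|a0] := eqVneq a 0; last by apply: (cyc a b c).
have [b0|b0] := eqVneq b 0; last by have [] := cyc b c a b1 c1 a1 b2 c2 a2.
have [c0|c0] := eqVneq c 0; last by have [] := cyc c a b c1 a1 b1 c2 a2 b2.
by move: u0; rewrite a0 b0 c0 eqxx.
Qed.

(** Coordinates of a matrix modulo scalar matrices. *)
Definition axis (A : 'M[int]_2) : int * int * int :=
  (A 0 1, A 1 0, A 0 0 - A 1 1).

(** The entries of the commutator of two 2x2 matrices are, up to sign, those of the
cross product of their classes modulo scalars. *)
Lemma commute_parallel (A B : 'M[int]_2) :
  A * B = B * A <-> parallel (axis A) (axis B).
Proof.
rewrite /parallel /=; split=> [AB|[e1 e2 e3]].
  have := congr1 (fun M : 'M[int]_2 => M 0 0) AB.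
  have := congr1 (fun M : 'M[int]_2 => M 0 1) AB.
  have := congr1 (fun M : 'M[int]_2 => M 1 0) AB.
  by rewrite /= !mulmx2E; split; lra.
by apply: matrix2P; rewrite !mulmx2E; lra.
Qed.

(** * Ping-pong for two transvections *)

(** The letter x is a generator, x.1 saying which one, or its inverse if x.2. *)
Definition transvection (c : int) (x : bool * bool) : 'M[int]_2 :=
  1 + (if x.2 then - c else c) *: (if x.1 then delta_mx 1 0 else delta_mx 0 1).

Lemma transvectionE c x :
  [/\ transvection c x 0 0 = 1, transvection c x 1 1 = 1,
      transvection c x 0 1 = (if x.1 then 0 else if x.2 then - c else c) &
      transvection c x 1 0 = (if x.1 then if x.2 then - c else c else 0)].
Proof.
by case: x => [[] e]; rewrite /transvection /= !mxE /= !mulr0 !addr0 ?add0r ?mulr1.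
Qed.

Lemma transvectionM c d x :
  transvection c x * transvection d x = transvection (c + d) x.
Proof.
have [a1 a2 a3 a4] := transvectionE c x.
have [b1 b2 b3 b4] := transvectionE d x.
have [c1 c2 c3 c4] := transvectionE (c + d) x.
apply: matrix2P; rewrite mulmx2E ?a1 ?a2 ?a3 ?a4 ?b1 ?b2 ?b3 ?b4 ?c1 ?c2 ?c3 ?c4;
  by case: x.1; case: x.2; ring.
Qed.

Lemma transvectionV c x : transvection c x * transvection c (inv_letter x) = 1.
Proof.
have -> : transvection c (inv_letter x) = transvection (- c) x.
  by case: x => e [] /=; rewrite /transvection /= ?opprK.
by rewrite transvectionM subrr /transvection oppr0 if_same scale0r addr0.
Qed.

Lemma axis_conj_upper c (A : 'M[int]_2) :
  axis (transvection c (false, true) * A * transvection c (false, false)) =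
  (A 0 1 + c * (A 0 0 - A 1 1) - c ^+ 2 * A 1 0, A 1 0,
   A 0 0 - A 1 1 - 2 * c * A 1 0).
Proof.
have [t1 t2 t3 t4] := transvectionE c (false, false).
have [u1 u2 u3 u4] := transvectionE c (false, true).
by rewrite /axis !mulmx2E t1 t2 t3 t4 u1 u2 u3 u4 /=; congr (_, _, _); ring.
Qed.

Lemma axis_conj_lower c (A : 'M[int]_2) :
  axis (transvection c (true, true) * A * transvection c (true, false)) =
  (A 0 1, A 1 0 - c * (A 0 0 - A 1 1) - c ^+ 2 * A 0 1,
   A 0 0 - A 1 1 + 2 * c * A 0 1).
Proof.
have [t1 t2 t3 t4] := transvectionE c (true, false).
have [u1 u2 u3 u4] := transvectionE c (true, true).
by rewrite /axis !mulmx2E t1 t2 t3 t4 u1 u2 u3 u4 /=; congr (_, _, _); ring.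
Qed.

Definition mx_of (c : int) (w : seq (bool * bool)) : 'M[int]_2 :=
  \prod_(x <- w) transvection c x.

(** The regions of the plane for the ping-pong: x.1 selects the larger coordinate, and
x.2 the sign of the product of the coordinates. *)
Definition dominated (x : bool * bool) (p q : int) : Prop :=
  0 < (-1) ^+ x.2 * (p * q) /\ (if x.1 then p ^+ 2 < q ^+ 2 else q ^+ 2 < p ^+ 2).

Lemma dominated_start y : dominated y
  (1 + (if y.1 then 0 else if y.2 then - 6 else 6) * 1)
  (1 + (if y.1 then if y.2 then - 6 else 6 else 0) * 1).
Proof. by case: y => [[] []]. Qed.

Lemma dominated_step y z p q : y != inv_letter z -> dominated z p q ->
  dominated y (p + (if y.1 then 0 else if y.2 then - 6 else 6) * q)
              (q + (if y.1 then if y.2 then - 6 else 6 else 0) * p).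
Proof.
have s1 := sqr_ge0 (p + q); have s2 := sqr_ge0 (p - q).
have s3 := sqr_ge0 p; have s4 := sqr_ge0 q.
rewrite /dominated => yz [].
case: y yz => [[] []];
  case: z => [[] []] //= _; rewrite ?expr0 ?expr1 => pq zpq; split; lra.
Qed.

(** The vector (1, 1) lies in no region and every letter moves it into its own; a
letter moves the region of any letter but its inverse into its own region. *)
Lemma ping_pong w : reduced w ->
  forall x w', w = x :: w' ->
  dominated x (mx_of 6 w 0 0 + mx_of 6 w 0 1) (mx_of 6 w 1 0 + mx_of 6 w 1 1).
Proof.
elim: w => // y w IH yw x _ [<- _].
have : let p := mx_of 6 w 0 0 + mx_of 6 w 0 1 in
    let q := mx_of 6 w 1 0 + mx_of 6 w 1 1 in
    p = 1 /\ q = 1 \/ exists z, y != inv_letter z /\ dominated z p q.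
  case: w yw IH => [|z w] yw IH.
    by left; rewrite /mx_of big_nil !mxE.
  right; exists z; split; last exact: IH (path_sorted yw) _ _ erefl.
  have /andP[zy _] := yw.
  by apply: contraNN zy => /eqP ->; rewrite inv_letterK.
set p := mx_of 6 w 0 0 + mx_of 6 w 0 1.
set q := mx_of 6 w 1 0 + mx_of 6 w 1 1 => /= pq1.
have -> : mx_of 6 (y :: w) 0 0 + mx_of 6 (y :: w) 0 1 =
    p + (if y.1 then 0 else if y.2 then - 6 else 6) * q.
  have [e1 e2 e3 e4] := transvectionE 6 y.
  by rewrite /mx_of big_cons !mulmx2E e1 e3 -/(mx_of 6 w) /p /q; ring.
have -> : mx_of 6 (y :: w) 1 0 + mx_of 6 (y :: w) 1 1 =
    q + (if y.1 then if y.2 then - 6 else 6 else 0) * p.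
  have [e1 e2 e3 e4] := transvectionE 6 y.
  by rewrite /mx_of big_cons !mulmx2E e2 e4 -/(mx_of 6 w) /p /q; ring.
by case: pq1 => [[-> ->]|[z [yz]]]; [exact: dominated_start|exact: dominated_step].
Qed.


(** A scalar matrix leaves (1, 1) on the diagonal, which avoids all the regions. *)
Lemma mx_of_nonscalar w : reduced w -> axis (mx_of 6 w) = 0 -> w = [::].
Proof.
case: w => [//|x w] rw [e01 e10 /eqP]; rewrite subr_eq0 => /eqP e00.
have [_] := ping_pong rw erefl.
by rewrite e01 e10 e00 addr0 add0r; case: x.1; rewrite ltxx.
Qed.

(** * Commutation in the free group of rank 2 *)

Local Notation F2 := (free_group bool).

Lemma mx_ofM (g h : F2) : mx_of 6 (g * h)%g = mx_of 6 g * mx_of 6 h.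
Proof. by apply: big_fg_mul; exact: transvectionV. Qed.

Lemma axis_mx_of_eq0 (g : F2) : axis (mx_of 6 g) = 0 -> g = 1%g.
Proof. by move=> /(mx_of_nonscalar (fg_reduced g)) g0; apply: val_inj. Qed.

Lemma mx_of1 : mx_of 6 (1%g : F2) = 1.
Proof. by rewrite /mx_of big_nil. Qed.

Lemma mx_of_inj (g h : F2) : mx_of 6 g = mx_of 6 h -> g = h.
Proof.
move=> gh; apply: divg1_eq; apply: axis_mx_of_eq0.
by rewrite mx_ofM gh -mx_ofM mulgV mx_of1 /axis !mxE subrr.
Qed.

Lemma commute_mx_of (g h : F2) :
  commute g h <-> parallel (axis (mx_of 6 g)) (axis (mx_of 6 h)).
Proof.
rewrite -commute_parallel -!mx_ofM; split=> [->//|]; exact: mx_of_inj.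
Qed.

(** Commutation becomes parallelism of axes, and the axis of a nontrivial element is
nonzero. *)
Lemma free2_commute_trans (x y z : F2) : x != 1%g ->
  commute x y -> commute x z -> commute y z.
Proof.
move=> x1 /commute_mx_of xy /commute_mx_of xz; apply/commute_mx_of.
apply: parallel_trans xy xz; apply: contraNneq x1 => x0.
by apply/eqP/axis_mx_of_eq0.
Qed.

(** Conjugating by a transvection has to preserve the direction of the axis of w,
hence this is the axis of the transvection: impossible for both transvections. *)
Lemma free2_no_abelian_normal (w : F2) :
  (forall k, commute w (w ^ k)%g) -> w = 1%g.
Proof.
move=> wk; apply: axis_mx_of_eq0.
have conj x : parallel (axis (mx_of 6 w))
    (axis (transvection 6 (inv_letter x) * mx_of 6 w * transvection 6 x)).
  have := wk (fg_letter x) => /commute_mx_of; rewrite conjgE mulgA.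
  have -> : (fg_letter x)^-1%g = fg_letter (inv_letter x).
    exact/mulg1_eq/fg_letter_inv.
  by rewrite !mx_ofM /mx_of !big_seq1.
have := conj (true, false).
rewrite (_ : inv_letter (true, false) = (true, true)) // axis_conj_lower.
have := conj (false, false).
rewrite (_ : inv_letter (false, false) = (false, true)) // axis_conj_upper.
rewrite /parallel /axis /=.
move: (mx_of 6 w 0 0) (mx_of 6 w 0 1) (mx_of 6 w 1 0) (mx_of 6 w 1 1) => p q r s.
move=> [a1 a2 a3] [b1 b2 b3].
have r0 : r = 0.
  by apply/eqP; rewrite -sqrf_eq0; apply/eqP; clear -a2; lra.
have q0 : q = 0.
  by apply/eqP; rewrite -sqrf_eq0; apply/eqP; clear -b3; lra.
have d0 : p - s = 0.
  by apply/eqP; rewrite -sqrf_eq0; apply/eqP; clear -a3 r0 q0; subst q r; lra.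
by rewrite r0 q0 d0.
Qed.

(** The homomorphism sending the two generators to the squares of the generators
named by s. *)
Definition fg_squares (S : choiceType) (s : bool -> S) (w : F2) : free_group S :=
  (\prod_(x <- w) fg_letter (s x.1, x.2) ^+ 2)%g.

Lemma fg_squaresM (S : choiceType) (s : bool -> S) :
  {morph fg_squares s : g h / (g * h)%g}.
Proof.
apply: big_fg_mul => x /=; rewrite !expg2.
set l := fg_letter (s x.1, x.2); set m := fg_letter _.
have lm : (l * m)%g = 1%g by exact: fg_letter_inv.
by rewrite mulgA -(mulgA l l m) lm mulg1.
Qed.

(** Sending these generators to transvections of parameter 3, and the other generators
to 1, represents their squares by the transvections of parameter 6. *)
Lemma fg_squares_inj (S : choiceType) (s : bool -> S) : injective s ->
  forall w, fg_squares s w = 1%g -> w = 1%g.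
Proof.
move=> s_inj w w1.
pose psi (x : S * bool) : 'M[int]_2 :=
  if x.1 == s false then transvection 3 (false, x.2)
  else if x.1 == s true then transvection 3 (true, x.2) else 1.
have psiV x : psi x * psi (inv_letter x) = 1.
  rewrite /psi /=; case: ifP => _; first exact: (transvectionV 3 (false, x.2)).
  by case: ifP => _; rewrite ?mulr1 //; exact: (transvectionV 3 (true, x.2)).
have psiM (u v : free_group S) :
    \prod_(x <- (u * v)%g) psi x = (\prod_(x <- u) psi x) * \prod_(x <- v) psi x.
  by apply: big_fg_mul.
have psi1 : \prod_(x <- (1%g : free_group S)) psi x = 1 by rewrite big_nil.
apply: axis_mx_of_eq0; suff -> : mx_of 6 w = 1 by rewrite /axis !mxE subrr.
rewrite -psi1 -w1 /fg_squares.
rewrite (big_morph (fun u : free_group S => \prod_(x <- u) psi x) psiM psi1).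
apply: eq_bigr => -[b e] _; rewrite expg2 psiM !big_seq1 /psi /=.
rewrite !(inj_eq s_inj); case: b => /=; exact/esym/transvectionM.
Qed.

Lemma fg_letter_neq1 (S : choiceType) (x : S * bool) : fg_letter x != 1%g.
Proof. by rewrite fg_word_eq1. Qed.

Lemma fg_squares1 (S : choiceType) (s : bool -> S) : fg_squares s 1%g = 1%g.
Proof. by rewrite /fg_squares big_nil. Qed.

Lemma fg_squares_letter (S : choiceType) (s : bool -> S) x :
  fg_squares s (fg_letter x) = (fg_letter (s x.1, x.2) ^+ 2)%g.
Proof. by rewrite /fg_squares big_seq1. Qed.

(** * The action on the leaves of the cube *)

Section VerticalAction.
Variables (R : realType) (m : nat).
Local Notation Q := (cube R m.+1).
Implicit Types (f g : Q -> Q) (omega p q : Q) (s t : R).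

Definition height (p : Q) : R := val p ord0 ord_max.

Definition same_leaf (p q : Q) : Prop :=
  forall i, i != ord_max -> val p ord0 i = val q ord0 i.

Lemma same_leaf_trans p q omega :
  same_leaf p q -> same_leaf q omega -> same_leaf p omega.
Proof. by move=> pq qo i im; rewrite pq // qo. Qed.

Lemma same_leaf_sym p q : same_leaf p q -> same_leaf q p.
Proof. by move=> pq i im; rewrite pq. Qed.

Lemma height_inj p q : same_leaf p q -> height p = height q -> p = q.
Proof.
move=> pq hpq; apply: val_inj; apply/rowP => i.
by have [->|im] := eqVneq i ord_max; [exact: hpq|exact: pq].
Qed.

Lemma height_itv p : 0 <= height p <= 1.
Proof. by have /set_mem := valP p; apply. Qed.

(** The height is clamped to [0, 1] so that [at_height] is a continuous total map to
the cube. *)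
Definition row_at (omega : Q) (t : R) : 'rV[R]_m.+1 :=
  \row_i (if i == ord_max then Num.max 0 (Num.min t 1) else val omega ord0 i).

Lemma row_at_cube omega t : row_at omega t \in Q.
Proof.
apply/mem_set => i; rewrite mxE; case: ifP => _.
  by rewrite le_max lexx ge_max ler01 ge_min lexx orbT.
by have /set_mem := valP omega; apply.
Qed.

Definition at_height (omega : Q) (t : R) : Q :=
  exist (fun v => v \in Q) _ (row_at_cube omega t).

Lemma height_at omega t : 0 <= t <= 1 -> height (at_height omega t) = t.
Proof. by move=> /andP[t0 t1]; rewrite /height /= mxE eqxx min_l // max_r. Qed.

Lemma same_leaf_at omega t : same_leaf (at_height omega t) omega.
Proof. by move=> i im; rewrite /= mxE (negbTE im). Qed.

Lemma at_heightK p : at_height p (height p) = p.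
Proof.
apply: height_inj; first exact: same_leaf_at.
by rewrite height_at // height_itv.
Qed.

Lemma at_height_eq omega p t : same_leaf p omega -> height p = t ->
  at_height omega t = p.
Proof.
move=> po <-; apply: height_inj; last by rewrite height_at // height_itv.
by apply: same_leaf_trans (same_leaf_at _ _) _; exact: same_leaf_sym.
Qed.

Lemma continuous_clamp : continuous (fun t : R => Num.max 0 (Num.min t 1)).
Proof.
move=> t; apply: (@continuous_max R R (cst 0) (fun t => Num.min t 1)).
  exact: cst_continuous.
apply: (@continuous_min R R id (cst 1)); [exact: cvg_id|exact: cst_continuous].
Qed.

Lemma continuous_at_height omega : continuous (at_height omega).
Proof.
apply: (@continuous_comp_initial _ _ _ (@set_val _ Q)) => t A [P tP PA].
have Pij i j : nbhs t [set s | P i j (row_at omega s i j)].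
  have := tP i j; rewrite /= !mxE; case: ifP => jm tPij.
    by have := continuous_clamp tPij; apply: (@filterS _ (nbhs t)) => s /=; rewrite mxE jm.
  by apply: (@filterE _ (nbhs t)) => s /=; rewrite mxE jm; exact: nbhs_singleton.
have nbhst : Filter (nbhs t) by exact: nbhs_filter.
have := filter_forall nbhst (fun i => filter_forall nbhst (Pij i)).
by apply: (@filterS _ (nbhs t)) => s Ps; exact: PA.
Qed.

Lemma continuous_height : continuous height.
Proof.
move=> p; apply: (@continuous_comp _ _ _ (@set_val _ Q)
  (fun M : 'rV[R]_m.+1 => M ord0 ord_max)).
  exact: initial_continuous.
exact: coord_continuous.
Qed.

Definition vertical f : Prop := forall p, same_leaf (f p) p.

(** Leaves are indexed, with repetitions, by the points of the cube, and the action on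
each leaf is extended by the identity to the whole line. *)
Definition leaf_act f (omega : Q) (t : R) : R :=
  if 0 <= t <= 1 then height (f (at_height omega t)) else t.

Lemma leaf_act_id omega t : leaf_act id omega t = t.
Proof. by rewrite /leaf_act; case: ifP => // t01; exact: height_at. Qed.

Lemma leaf_act_comp f g omega t : vertical g ->
  leaf_act (f \o g) omega t = leaf_act f omega (leaf_act g omega t).
Proof.
move=> gv; rewrite {1 3}/leaf_act; case: ifP => t01; last by rewrite /leaf_act t01.
rewrite /leaf_act height_itv /=; congr (height (f _)).
apply/esym/at_height_eq => //; apply: same_leaf_trans (gv _) _.
exact: same_leaf_at.
Qed.

Lemma leaf_act_eq_id f : vertical f ->
  (forall omega t, leaf_act f omega t = t) -> f = id.
Proof.
move=> fv fid; apply/funext => p; apply: height_inj; first exact: fv.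
by have := fid p (height p); rewrite /leaf_act height_itv at_heightK.
Qed.

(** On [0, 1] a continuous injective map is increasing or decreasing; composed with
itself it is increasing in both cases. *)
Lemma leaf_act_square_mono f omega : vertical f -> injective f -> continuous f ->
  {mono leaf_act (f \o f) omega : s t / s <= t}.
Proof.
move=> fv f_inj fc.
pose h t := height (f (at_height omega t)).
have hI : {in `[0, 1] &, injective h}.
  move=> s t; rewrite !in_itv /= => s01 t01 hst.
  have /f_inj/(congr1 height) : f (at_height omega s) = f (at_height omega t).
    apply: height_inj => //; apply: same_leaf_trans (fv _) _.
    apply: same_leaf_trans (same_leaf_at _ _) _; apply: same_leaf_sym.
    by apply: same_leaf_trans (fv _) _; exact: same_leaf_at.
  by rewrite !height_at.
have hC : {within [set` `[0, 1]], continuous h}.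
  apply: continuous_subspaceT => t.
  apply: (@continuous_comp _ _ _ (at_height omega) (height \o f)).
    exact: continuous_at_height.
  by apply: continuous_comp; [exact: fc|exact: continuous_height].
have h01 t : h t \in `[0, 1] by rewrite in_itv /= height_itv.
have hh t : 0 <= t <= 1 -> leaf_act (f \o f) omega t = h (h t).
  move=> t01; rewrite leaf_act_comp // /leaf_act t01 -/(h t).
  by have := h01 t; rewrite in_itv /= => ->.
have hh_lt : {in `[0, 1] &, {homo h \o h : s t / s < t}}.
  have [hinc|hdec] := itv_continuous_inj_mono hC hI => s t sI tI st /=.
    exact/hinc/hinc.
  exact/hdec/hdec.
apply: le_mono => s t st.
have [/andP[s0 s1]|s01] := boolP (0 <= s <= 1);
  have [/andP[t0 t1]|t01] := boolP (0 <= t <= 1).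
- by rewrite !hh ?s0 ?s1 ?t0 ?t1 //; apply: hh_lt; rewrite ?in_itv /= ?s0 ?s1 ?t0 ?t1.
- rewrite hh ?s0 ?s1 // /leaf_act (negbTE t01).
  have := h01 (h s); rewrite in_itv /= => /andP[_ hs1].
  move: t01; rewrite negb_and -!ltNge => /orP[]; lra.
- rewrite [X in _ < X]hh ?t0 ?t1 // /leaf_act (negbTE s01).
  have := h01 (h t); rewrite in_itv /= => /andP[hs1 _].
  move: s01; rewrite negb_and -!ltNge => /orP[]; lra.
- by rewrite /leaf_act (negbTE s01) (negbTE t01).
Qed.

Lemma conv_hull_convex n (V : {fset 'rV[R]_n}) (u v : 'rV[R]_n) (l : R) :
  0 <= l <= 1 -> conv_hull V u -> conv_hull V v ->
  conv_hull V (l *: u + (1 - l) *: v).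
Proof.
move=> /andP[l0 l1] [a [a0 a1 ->]] [b [b0 b1 ->]].
exists (fun x => l * a x + (1 - l) * b x); split.
- move=> x xS; have := a0 x xS; have := b0 x xS; nra.
- by rewrite big_split /= -!mulr_sumr a1 b1; ring.
rewrite !scaler_sumr -big_split /=; apply: eq_bigr => x _.
by rewrite !scalerA -scalerDl.
Qed.

Definition trace (V : {fset 'rV[R]_m.+1}) omega : set R :=
  [set t | 0 <= t <= 1 /\ conv_hull V (val (at_height omega t))].

Lemma trace_convex V omega s t u : trace V omega s -> trace V omega t ->
  s <= u <= t -> trace V omega u.
Proof.
move=> [s01 Ss] [t01 St] /andP[su ut].
have u01 : 0 <= u <= 1 by lra.
split => //; have [st|st] := eqVneq s t.
  by have -> : u = s by lra.
have d0 : t - s > 0 by rewrite subr_gt0 lt_neqAle st (le_trans su ut).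
pose l := (t - u) / (t - s).
have l01 : 0 <= l <= 1.
  by apply/andP; split; [apply: divr_ge0; lra|rewrite ler_pdivrMr //; lra].
have := conv_hull_convex l01 Ss St; congr (conv_hull _ _).
apply/rowP => i; rewrite !mxE; have [_|_] := eqVneq i ord_max; last by ring.
move: s01 t01 u01 => /andP[? ?] /andP[? ?] /andP[? ?].
rewrite !(min_l, max_r) //.
by rewrite /l; field; rewrite gt_eqF.
Qed.

Lemma leaf_act_affine f V A b omega t : agrees_with_affine f V A b ->
  trace V omega t ->
  leaf_act f omega t = A ord_max ord_max * t +
    (b ord0 ord_max + \sum_(i | i != ord_max) val omega ord0 i * A i ord_max).
Proof.
move=> fA [t01 St]; rewrite /leaf_act t01 /height fA // !mxE.
rewrite (bigD1 ord_max) //= {1}mxE eqxx -addrA [X in _ + X]addrC.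
have -> : Num.max 0 (Num.min t 1) = t.
  by move: t01 => /andP[? ?]; rewrite min_l // max_r.
rewrite mulrC; congr (_ + (_ + _)); apply: eq_bigr => i im.
by rewrite mxE (negbTE im).
Qed.

(** Let [s, t] contain neither 0 nor 1 nor the top of the intersection of the leaf with
a simplex.  If it lies inside [0, 1], then s belongs to some simplex, whose
intersection with the leaf extends beyond t and thus contains [s, t], by
convexity. *)
Lemma leaf_act_piecewise_affine f : piecewise_linear f ->
  exists bs, piecewise_affine bs (leaf_act f).
Proof.
move=> [K [_ _ _ Kcube] Kf].
pose top V omega := sup (trace V omega).
exists [:: cst 0, cst 1 & [seq top V | V <- enum_fset K]].
move=> omega s t st gap.
have gap0 : ~~ (s <= 0 <= t) by apply: (gap (cst 0)); rewrite !inE eqxx.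
have gap1 : ~~ (s <= 1 <= t) by apply: (gap (cst 1)); rewrite !inE eqxx orbT.
have gapS V : V \in K -> ~~ (s <= top V omega <= t).
  by move=> SK; apply: gap; rewrite !inE map_f ?orbT.
have [s0|s0] := ltP s 0.
  exists 1, 0 => u /andP[su ut]; rewrite /leaf_act ifF; first by ring.
  by apply/negbTE; move: gap0; rewrite !negb_and -!ltNge; lra.
have [s1|s1] := ltP 1 s.
  exists 1, 0 => u /andP[su ut]; rewrite /leaf_act ifF; first by ring.
  by apply/negbTE; rewrite !negb_and -!ltNge; lra.
have s01 : 0 <= s <= 1 by rewrite s0 s1.
have [V /= SK Ss] : (\bigcup_(V in [set` K]) conv_hull V) (val (at_height omega s)).
  by rewrite Kcube; apply/set_mem; exact: valP.
have [A [b fA]] := Kf V SK.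
have traces : trace V omega s by [].
have ub : has_ubound (trace V omega) by exists 1 => u [/andP[]].
have stop : s <= top V omega by exact: ub_le_sup.
have [u Su tu] : exists2 u, trace V omega u & t < u.
  apply: sup_gt; first by exists s.
  by move: (gapS V SK); rewrite stop /= -ltNge.
exists (A ord_max ord_max),
  (b ord0 ord_max + \sum_(i | i != ord_max) val omega ord0 i * A i ord_max).
move=> v /andP[sv vt]; apply: leaf_act_affine fA _.
by apply: trace_convex traces Su _; rewrite sv (le_trans vt (ltW tu)).
Qed.

Lemma piecewise_affine_sub (bs bs' : seq (Q -> R)) (h : Q -> R -> R) :
  {subset bs <= bs'} -> piecewise_affine bs h -> piecewise_affine bs' h.
Proof.
move=> sub haff omega s t st gap; apply: haff => // b /sub; exact: gap.
Qed.

Lemma PLF_vertical (f : homeo Q) : PLF R m.+1 f -> vertical f.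
Proof.
move=> [_ fleaf] p i im.
have im' : (i < m)%N.
  by rewrite ltn_neqAle -ltnS ltn_ord andbT; apply: contraNneq im => e;
    apply/eqP/val_inj.
pose x : 'rV[R]_m := \row_j val p ord0 (widen_ord (leq_pred m.+1) j).
have xc : cube R m x by move=> j; rewrite mxE; have /set_mem := valP p; apply.
have pl : leaf (n := m.+1) x p by move=> j; rewrite /= mxE.
have : leaf (n := m.+1) x (f p) by rewrite -(fleaf x xc); exists p.
move=> /(_ (Ordinal im')); rewrite mxE.
by rewrite (_ : widen_ord _ _ = i) //; exact: val_inj.
Qed.

End VerticalAction.

(** * Absence of free subgroups *)

Theorem proposition3p4 (R : realType) (n : nat) (n_ge1 : (1 <= n)%N) :
  ~ exists (H : set (homeo (cube R n))) (S : choiceType),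
      [/\ is_subgroup H, H `<=` PLF R n, (exists a b : S, a != b)
        & isomorphic_to_subgroup (free_group S) H].
Proof.
case: n n_ge1 => // m _ [H [S [_ H_PLF [a [b ab]] [phi [phi_inj phiH]]]]].
pose s (e : bool) := if e then b else a.
have s_inj : injective s.
  by move=> [] [] //= /eqP e; move: ab; rewrite ?e // eq_sym e.
have phi_PLF u : PLF R m.+1 (phi u) by apply: H_PLF; rewrite -phiH; exists u.
have phi_vert u := PLF_vertical (phi_PLF u).
pose hm (w : free_group bool) := phi (fg_squares s w).
have phi1 : phi 1%g = 1%g.
  by apply: (mulgI (phi 1%g)); rewrite -gmulfM !mulg1.
have hm1 : hm 1%g = 1%g by rewrite /hm fg_squares1.
have hmM g h : hm (g * h)%g = (hm g * hm h)%g by rewrite /hm fg_squaresM gmulfM.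
pose act w := leaf_act (hm w).
have actM g h omega t : act (g * h)%g omega t = act g omega (act h omega t).
  by rewrite /act hmM; apply: leaf_act_comp; exact: phi_vert.
pose gens := [seq fg_letter x | x : bool * bool].
have act_affine (x : bool * bool) :
    exists bs, piecewise_affine bs (act (fg_letter x)).
  by apply: leaf_act_piecewise_affine; have [[]] := phi_PLF (fg_squares s (fg_letter x)).
have [bs bsP] := choice act_affine.
have trivial : forall w : free_group bool, w = 1%g.
  apply: (@piecewise_affine_action_trivial R (cube R m.+1) _ act gens
    (flatten [seq bs x | x : bool * bool])).
  - by move=> omega t; rewrite /act hm1; exact: leaf_act_id.
  - exact: actM.
  - apply: fg_letter_ind => [omega u v|x omega u v|g h IHg IHh omega u v].
    + by rewrite /act hm1 !leaf_act_id.
    + rewrite /act /hm fg_squares_letter expg2 gmulfM.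
      apply: leaf_act_square_mono => //.
        exact: can_inj (@homeo_funK _ _).
      exact: homeo_fun_continuous.
    + by rewrite !actM IHg IHh.
  - move=> w w_id; apply: (fg_squares_inj s_inj); apply: phi_inj; rewrite phi1.
    by apply: homeoP; apply: leaf_act_eq_id.
  - move=> P P1 Pgen PM; apply: fg_letter_ind => // x; apply: Pgen.
    exact: fintype.image_f.
  - move=> _ /fintype.imageP[x _ ->]; apply: piecewise_affine_sub (bsP x) => c cx.
    by apply/flattenP; exists (bs x) => //; exact: fintype.image_f.
  - exact: free2_commute_trans.
  - exact: free2_no_abelian_normal.
by have := fg_letter_neq1 (false, false); rewrite (trivial (fg_letter _)) eqxx.
Qed.
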